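(* Let $n\ge 1$, let $\mathfrak{g}_{\mathbb{R}\mathrm{H}^{2n}}$ be the real Lie algebra with basis $\{e_1,\ldots,e_{2n}\}$ and bracket relations $[e_1,e_k]=e_k$ for $k=2,\ldots,2n$, and let $\omega\in\Omega(\mathfrak{g}_{\mathbb{R}\mathrm{H}^{2n}})$. Then $d\omega=0$ if and only if $n=1$.
   Context: All brackets of basis vectors not determined by the listed ones through antisymmetry are zero. $\Omega(\mathfrak{g})$ denotes the set of nondegenerate alternating bilinear forms ($2$-forms) on the vector space $\mathfrak{g}$. For $\omega\in\Omega(\mathfrak{g})$, $d\omega(x,y,z):=\omega(x,[y,z])+\omega(z,[x,y])+\omega(y,[z,x])$ for $x,y,z\in\mathfrak{g}$. *)

(* Defs.v *)
From HB Require Import structures.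
From mathcomp Require Import all_boot all_order all_algebra.
From mathcomp Require Import reals ring.

Set Implicit Arguments.
Unset Strict Implicit.
Unset Printing Implicit Defensive.

Import GRing.Theory.
Local Open Scope ring_scope.

HB.mixin Record Lmodule_isLie (K : fieldType) (L : Type) of GRing.Lmodule K L :=
  { lie : {bilinear L -> L -> L};
    lie_alternating : forall x : L, lie x x = 0;
    lie_jacobi : forall x y z : L,
      lie x (lie y z) + lie y (lie z x) + lie z (lie x y) = 0 }.

#[short(type="lieAlgType")]
HB.structure Definition LieAlgebra (K : fieldType) :=
  { L of Vector K L & Lmodule_isLie K L }.

Notation "[| x , y |]" := (lie x y)
  (at level 0, x, y at level 99, format "[|  x ,  y  |]") : ring_scope.

(* The library's [nondegenerate] is only available for forms packaged as
   hermitian (here, skew-symmetric) ones, so nondegeneracy of a bare bilinear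
   form is spelled out. *)
Definition nondegenerate_alternating (K : fieldType) (V : vectType K)
    (omega : {biscalar V}) : Prop :=
  (forall x : V, omega x x = 0) /\
  (forall x : V, (forall y : V, omega x y = 0) -> x = 0).

Definition form_diff (K : fieldType) (g : lieAlgType K) (omega : {biscalar g})
    (x y z : g) : K :=
  omega x [| y, z |] + omega z [| x, y |] + omega y [| z, x |].

(* [e] is a basis of [g] with the bracket relations of the Lie algebra of real
   hyperbolic space of dimension [m]. Indices are shifted by one: the
   mathematical basis vector e_k is [e`_(k.-1)], so e_1 is [e`_0]. The relations
   [| e`_j, e`_0 |] = - e`_j and [| e`_0, e`_0 |] = 0 hold by antisymmetry. *)
Definition RH_basis (K : fieldType) (g : lieAlgType K) (m : nat)
    (e : m.-tuple g) : Prop :=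
  [/\ basis_of fullv e,
      forall k, (0 < k < m)%N -> [| e`_0, e`_k |] = e`_k
    & forall j k, (0 < j < m)%N -> (0 < k < m)%N -> [| e`_j, e`_k |] = 0].

(* A concrete model on the coordinate space K^(m+1), so that [RH_basis] is not
   vacuous. *)
Module RHModel.
Section Model.
Variables (K : fieldType) (m : nat).

Definition space := 'rV[K]_m.+1.
HB.instance Definition _ := Vector.on space.

Definition br (x y : space) : space := x 0 0 *: y - y 0 0 *: x.

Lemma br_bilinear : bilinear_for
  (GRing.Scale.Law.clone _ _ *:%R _) (GRing.Scale.Law.clone _ _ *:%R _) br.
Proof. by split=> [u|u] a x y; apply/rowP=> j; rewrite /br !mxE; ring. Qed.

HB.instance Definition _ :=
  bilinear_isBilinear.Build K space space space _ _ br br_bilinear.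

Lemma br_alternating (x : space) : br x x = 0.
Proof. exact: subrr. Qed.

Lemma br_jacobi (x y z : space) :
  br x (br y z) + br y (br z x) + br z (br x y) = 0.
Proof. by apply/rowP=> j; rewrite /br !mxE; ring. Qed.

HB.instance Definition _ :=
  Lmodule_isLie.Build K space br_alternating br_jacobi.

Definition alg : lieAlgType K := space.

Definition basis : m.+1.-tuple alg := [tuple delta_mx 0 i | i < m.+1].

Lemma basisE (i : 'I_m.+1) : basis`_i = delta_mx 0 i.
Proof. by rewrite -[basis`_i]tnth_nth tnth_mktuple. Qed.

Lemma basisP : RH_basis basis.
Proof.
split.
- rewrite basisEdim size_tuple dimvf /dim /= mul1n leqnn andbT.
  apply/subvP=> x _; rewrite [x]row_sum_delta; apply: memv_suml => i _.
  by rewrite memvZ // -basisE memv_span // mem_nth // size_tuple.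
- move=> k /andP[k0 km]; rewrite (basisE ord0) (basisE (Ordinal km)).
  apply/rowP=> j; rewrite /lie /= /br !mxE !eqxx /= mul1r.
  by rewrite [0 == _](_ : _ = false) ?mul0r ?subr0 //; case: k k0 km.
- move=> j k /andP[j0 jm] /andP[k0 km].
  rewrite (basisE (Ordinal jm)) (basisE (Ordinal km)).
  have neq0 i (im : (i < m.+1)%N) : (0 < i)%N -> (0 == Ordinal im) = false.
    by case: i im.
  by apply/rowP=> l; rewrite /lie /= /br !mxE !neq0 // andbF !mul0r subr0.
Qed.

End Model.
End RHModel.

Lemma RH_basis_exists (K : fieldType) (m : nat) : (0 < m)%N ->
  exists (g : lieAlgType K) (e : m.-tuple g), RH_basis e.
Proof.
case: m => // m _; exists (RHModel.alg K m), (RHModel.basis K m).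
exact: RHModel.basisP.
Qed.

(* Main.v *)
Require Import Defs.
From mathcomp Require Import all_boot all_order all_algebra.
From mathcomp Require Import reals.
From mathcomp Require Import ring.

Import GRing.Theory.
Local Open Scope ring_scope.

(** Evaluating the differential on [e_1, e_j, e_k] with [j, k >= 2] gives [-2 omega(e_j, e_k)], so a
    closed [omega] vanishes on the hyperplane spanned by [e_2, ..., e_2n] ([form_diff_RH]). A
    nondegenerate alternating form admits such a hyperplane only in dimension at most 2
    ([isotropic_hyperplane_dim_le2]), which forces [n = 1]. Conversely, the differential vanishes
    identically on any Lie algebra of dimension 2 ([form_diff_dim2]). *)

Lemma alternating_skew (K : fieldType) (V : vectType K) (omega : {biscalar V}) :
  (forall x, omega x x = 0) -> forall x y, omega y x = - omega x y.
Proof.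
move=> alt x y; have := alt (x + y).
rewrite linearDl !linearDr !alt /= add0r addr0 => /eqP.
by rewrite addrC addr_eq0 => /eqP.
Qed.

Lemma lie_skew (K : fieldType) (g : lieAlgType K) (x y : g) :
  [| y, x |] = - [| x, y |].
Proof.
have := lie_alternating (x + y).
rewrite linearDl !linearDr !lie_alternating /= add0r addr0 => /eqP.
by rewrite addrC addr_eq0 => /eqP.
Qed.

Lemma form_eq0_basis (K : fieldType) (V : vectType K) m (e : m.-tuple V)
    (omega : {biscalar V}) (x : V) :
  basis_of fullv e -> (forall k : 'I_m, omega x e`_k = 0) ->
  forall y, omega x y = 0.
Proof.
move=> eB xe0 y; rewrite (coord_basis eB (memvf y)) linear_sumr big1 // => k _.
by rewrite linearZr_LR xe0 /= mulr0.
Qed.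

(** In a basis [u, v], the bracket of two vectors is their determinant times [[| u, v |]]. The sum
    is thus [omega] of [det(y,z) x + det(x,y) z + det(z,x) y] against [[| u, v |]], and that vector
    is zero by Cramer's identity in the plane. *)
Lemma form_diff_dim2 (K : fieldType) (g : lieAlgType K) (omega : {biscalar g})
    (x y z : g) :
  \dim {:g} = 2%N -> form_diff omega x y z = 0.
Proof.
move=> g2; have := vbasisP {:g}; move: (vbasis _); rewrite g2 => e eB.
set u := e`_0; set v := e`_1.
have coordE w : exists a b, w = a *: u + b *: v.
  exists (coord e ord0 w), (coord e (lift ord0 ord0) w).
  by rewrite [LHS](coord_basis eB (memvf w)) big_ord_recl big_ord1.
have lieE a b c d :
    [| a *: u + b *: v, c *: u + d *: v |] = (a * d - b * c) *: [| u, v |].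
  rewrite linearDl !linearDr !linearZl_LR /= !linearZr_LR /=.
  rewrite !lie_alternating (lie_skew _ _ u v) !scaler0 add0r addr0 !scalerN.
  by rewrite !scalerA scalerBl.
have [a1 [b1 ->]] := coordE x; have [a2 [b2 ->]] := coordE y.
have [a3 [b3 ->]] := coordE z.
rewrite /form_diff !lieE !linearZr_LR /= !linearDl !linearZl_LR /=.
ring.
Qed.

(** The term in [[| e_j, e_k |]] dies; bracketing with [e_0] fixes [e_j] and [e_k], so the other two
    terms agree by skew-symmetry of [omega]. *)
Lemma form_diff_RH (K : fieldType) (g : lieAlgType K) m (e : m.-tuple g)
    (omega : {biscalar g}) j k :
  RH_basis e -> (forall x, omega x x = 0) -> (0 < j < m)%N -> (0 < k < m)%N ->
  form_diff omega e`_0 e`_j e`_k = - (omega e`_j e`_k *+ 2).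
Proof.
move=> [_ e0 ee] alt jm km.
rewrite /form_diff ee // e0 // (lie_skew _ _ e`_0) e0 // linear0r linearNr.
by rewrite (alternating_skew _ _ _ alt e`_j e`_k) add0r mulr2n opprD.
Qed.

(* If [2 < m], a nonzero combination of [e`_1] and [e`_2] orthogonal to [e`_0]
   lies in the radical of [omega]. *)
Lemma isotropic_hyperplane_dim_le2 (K : fieldType) (V : vectType K) m
    (e : m.-tuple V) (omega : {biscalar V}) :
  basis_of fullv e -> nondegenerate_alternating omega ->
  (forall j k, (0 < j < m)%N -> (0 < k < m)%N -> omega e`_j e`_k = 0) ->
  (m <= 2)%N.
Proof.
move=> eB [alt nondeg] iso; rewrite leqNgt; apply/negP => m2.
have m1 : (1 < m)%N := ltnW m2.
have rad a b : a * omega e`_0 e`_1 + b * omega e`_0 e`_2 = 0 ->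
    a *: e`_1 + b *: e`_2 = 0.
  move=> ab0; apply: nondeg.
  apply: (form_eq0_basis _ _ _ _ _ _ eB) => -[ [ |k] km] /=.
    rewrite linearDl !linearZl_LR /= !(alternating_skew _ _ _ alt e`_0).
    by rewrite !mulrN -opprD ab0 oppr0.
  by rewrite linearDl !linearZl_LR /= !iso // !mulr0 addr0.
have free12 a b : a *: e`_1 + b *: e`_2 = 0 -> a = 0 /\ b = 0.
  move=> ab0; have eF := basis_free eB.
  have coordE (i : 'I_m) j (jm : (j < m)%N) : coord e i e`_j = (j == i)%:R.
    exact: (coord_free (Ordinal jm) i eF).
  have c (i : 'I_m) := congr1 (coord e i) ab0.
  move: (c (Ordinal m1)) (c (Ordinal m2)).
  rewrite !linearD !linearZ /= !linear0.
  by rewrite !(coordE _ _ m1) !(coordE _ _ m2) /= !mulr1 !mulr0 addr0 add0r.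
(* These coefficients solve the orthogonality equation of [rad]; independence makes both zero. *)
have /free12[w02 /eqP] :
    omega e`_0 e`_2 *: e`_1 + (- omega e`_0 e`_1) *: e`_2 = 0.
  by apply: rad; ring.
rewrite oppr_eq0 => /eqP w01.
(* Now [e_1] itself is orthogonal to [e_0], hence in the radical, giving [1 = 0]. *)
have /free12[/eqP] : 1 *: e`_1 + 0 *: e`_2 = 0.
  by apply: rad; rewrite w01 mulr0 mul0r addr0.
by rewrite oner_eq0.
Qed.

Theorem corollary5p3 (R : realType) (n : nat) (hn : (1 <= n)%N)
    (g : lieAlgType R) (e : (2 * n).-tuple g) (he : RH_basis e)
    (omega : {biscalar g}) (homega : nondegenerate_alternating omega) :
  (forall x y z : g, form_diff omega x y z = 0) <-> n = 1%N.
Proof.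
have [eB _ _] := he; split=> [closed | n1 x y z].
  have : (2 * n <= 2 * 1)%N.
    apply: (isotropic_hyperplane_dim_le2 _ _ _ _ _ eB homega) => j k jm km.
    have := closed e`_0 e`_j e`_k; rewrite form_diff_RH //; last by case: homega.
    (* The factor 2 cancels because [R] has characteristic zero. *)
    by move/eqP; rewrite oppr_eq0 Num.Theory.mulrn_eq0 => /eqP.
  by rewrite leq_pmul2l // => n1; apply/eqP; rewrite eqn_leq n1.
by apply: form_diff_dim2; rewrite (size_basis eB) n1.
Qed.
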